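(* Let $a,b$ be commuting indeterminates. Let $R$ be a subset of the positive integers and let $\gamma$ be a map from $R$ to the positive integers. Let $\mathrm{Par}(R,\gamma)$ be the set of all integer partitions (including the empty partition) in which every $r\in R$ occurs as a part with multiplicity at most $\gamma(r)$. For a partition $\lambda=(\lambda_1\ge\lambda_2\ge\cdots)$ define $$\omega_2(\lambda)=a^{\sum_{i\ge1}\lceil\lambda_{2i-1}/2\rceil}\,b^{\sum_{i\ge1}\lfloor\lambda_{2i-1}/2\rfloor}\,a^{\sum_{i\ge1}\lceil\lambda_{2i}/2\rceil}\,b^{\sum_{i\ge1}\lfloor\lambda_{2i}/2\rfloor}$$ (so each part $\lambda_i$ contributes $a^{\lceil\lambda_i/2\rceil}b^{\lfloor\lambda_i/2\rfloor}$), and let $\Psi_{R,\gamma}(a,b,a,b)=\sum_{\lambda\in\mathrm{Par}(R,\gamma)}\omega_2(\lambda)$. Then, as formal power series, $\Psi_{R,\gamma}(a,b,a,b)=UV$, where $$U=\prod_{j=1}^{\infty}\frac{1+a^{\lceil\frac{j}{2}\rceil}b^{\lfloor\frac{j}{2}\rfloor}a^{\lceil\frac{j-1}{2}\rceil}b^{\lfloor\frac{j-1}{2}\rfloor}}{\left(1-a^{2\lceil\frac{j}{2}\rceil}b^{2\lfloor\frac{j}{2}\rfloor}\right)\left(1-a^{2j-1}b^{2j-1}\right)},\qquad V=\prod_{r\in R}\left(1-a^{\lceil\frac{r}{2}\rceil(\gamma(r)+1)}b^{\lfloor\frac{r}{2}\rfloor(\gamma(r)+1)}\right).$$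
   Context: A partition $\lambda$ is written with parts in nonincreasing order; parts beyond the length are taken to be $0$. *)

(* Defs.v *)
From HB Require Import structures.
From mathcomp Require Import all_boot all_order all_algebra finmap.
From mathcomp Require Import boolp classical_sets.
Set Implicit Arguments.
Unset Strict Implicit.
Unset Printing Implicit Defensive.
Import GRing.Theory.
Local Open Scope ring_scope.

(* K[[a, b]]: a power series is the family of its coefficients, [coef2 f i j]
   being the coefficient of a^i b^j. The record keeps the Cauchy product apart
   from the pointwise ring structure on functions. *)
Record fps2 (K : Type) := Fps2 { coef2 : nat -> nat -> K }.

HB.instance Definition _ (K : Type) := gen_eqMixin (fps2 K).
HB.instance Definition _ (K : Type) := gen_choiceMixin (fps2 K).

Lemma fps2P (K : Type) (f g : fps2 K) :
  (forall m n, coef2 f m n = coef2 g m n) -> f = g.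
Proof.
case: f g => [f] [g] /= fg; congr Fps2.
by apply/funext => m; apply/funext => n.
Qed.

Section Ring.
Variable K : comNzRingType.
Implicit Types f g h : fps2 K.

Definition fps2_zero : fps2 K := Fps2 (fun _ _ => 0).
Definition fps2_opp f : fps2 K := Fps2 (fun m n => - coef2 f m n).
Definition fps2_add f g : fps2 K := Fps2 (fun m n => coef2 f m n + coef2 g m n).
Definition fps2_one : fps2 K := Fps2 (fun m n => ((m == 0%N) && (n == 0%N))%:R).
Definition fps2_mul f g : fps2 K := Fps2 (fun m n =>
  \sum_(i < m.+1) \sum_(j < n.+1) coef2 f i j * coef2 g (m - i) (n - j)).

Fact fps2_addA : associative fps2_add.
Proof. by move=> f g h; apply: fps2P => m n /=; rewrite addrA. Qed.
Fact fps2_addC : commutative fps2_add.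
Proof. by move=> f g; apply: fps2P => m n /=; rewrite addrC. Qed.
Fact fps2_add0 : left_id fps2_zero fps2_add.
Proof. by move=> f; apply: fps2P => m n /=; rewrite add0r. Qed.
Fact fps2_addN : left_inverse fps2_zero fps2_opp fps2_add.
Proof. by move=> f; apply: fps2P => m n /=; rewrite addNr. Qed.

HB.instance Definition _ := GRing.isZmodule.Build (fps2 K)
  fps2_addA fps2_addC fps2_add0 fps2_addN.

Let tr N f : {poly {poly K}} := \poly_(i < N) \poly_(j < N) coef2 f i j.

Let trM N f g m n : (m < N)%N -> (n < N)%N ->
  coef2 (fps2_mul f g) m n = (tr N f * tr N g)`_m`_n.
Proof.
move=> mN nN /=; rewrite coefM coef_sum; apply: eq_bigr => i _.
have iN : (i < N)%N by apply: leq_ltn_trans mN; rewrite -ltnS.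
rewrite !coef_poly iN (leq_ltn_trans (leq_subr _ _) mN) coefM.
apply: eq_bigr => j _.
have jN : (j < N)%N by apply: leq_ltn_trans nN; rewrite -ltnS.
by rewrite !coef_poly jN (leq_ltn_trans (leq_subr _ _) nN).
Qed.

Fact fps2_mulC : commutative fps2_mul.
Proof.
move=> f g; apply: fps2P => m n.
have mN : (m < (m + n).+1)%N by rewrite ltnS leq_addr.
have nN : (n < (m + n).+1)%N by rewrite ltnS leq_addl.
by rewrite !(trM _ _ mN nN) mulrC.
Qed.

Let trMl N f g m n : (m < N)%N -> (n < N)%N ->
  (tr N (fps2_mul f g))`_m`_n = (tr N f * tr N g)`_m`_n.
Proof. by move=> mN nN; rewrite -trM // coef_poly mN coef_poly nN. Qed.

Fact fps2_mulA : associative fps2_mul.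
Proof.
move=> f g h; apply: fps2P => m n.
have mN : (m < (m + n).+1)%N by rewrite ltnS leq_addr.
have nN : (n < (m + n).+1)%N by rewrite ltnS leq_addl.
rewrite !(trM _ _ mN nN); set N := (m + n).+1 in mN nN *.
have trMr p q r : (tr N p * tr N (fps2_mul q r))`_m`_n
    = (tr N p * (tr N q * tr N r))`_m`_n.
  rewrite !(@coefM _ (tr N p)) !coef_sum; apply: eq_bigr => i _.
  rewrite !(@coefM _ (tr N p)`_i); apply: eq_bigr => j _; congr (_ * _).
  by rewrite trMl // (leq_ltn_trans (leq_subr _ _)).
rewrite trMr (mulrC (tr N (fps2_mul f g))) trMr.
by rewrite (mulrC (tr N h)) mulrA.
Qed.

Fact fps2_mul1 : left_id fps2_one fps2_mul.
Proof.
move=> f; apply: fps2P => m n /=.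
rewrite big_ord_recl big_ord_recl /= !subn0 mul1r.
rewrite big1 => [|j _]; last by rewrite mul0r.
rewrite big1 ?addr0 // => i _.
by rewrite big1 // => j _; rewrite mul0r.
Qed.

Fact fps2_mulDl : left_distributive fps2_mul fps2_add.
Proof.
move=> f g h; apply: fps2P => m n /=.
rewrite -big_split; apply: eq_bigr => i _ /=.
by rewrite -big_split; apply: eq_bigr => j _ /=; rewrite mulrDl.
Qed.

Fact fps2_one_neq0 : fps2_one != 0.
Proof.
apply/eqP => /(congr1 (fun f => coef2 f 0 0)) /= /eqP.
by rewrite oner_eq0.
Qed.

HB.instance Definition _ := GRing.Zmodule_isComNzRing.Build (fps2 K)
  fps2_mulA fps2_mulC fps2_mul1 fps2_mulDl fps2_one_neq0.

Lemma coef2M f g m n : coef2 (f * g) m n =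
  \sum_(i < m.+1) \sum_(j < n.+1) coef2 f i j * coef2 g (m - i) (n - j).
Proof. by []. Qed.

Lemma coef2_sum (I : Type) (r : seq I) (P : pred I) (F : I -> fps2 K) m n :
  coef2 (\sum_(i <- r | P i) F i) m n = \sum_(i <- r | P i) coef2 (F i) m n.
Proof. exact: (big_morph (fun f => coef2 f m n)). Qed.

Lemma coef2_exp_small h k m n :
  coef2 h 0 0 = 0 -> (m + n < k)%N -> coef2 (h ^+ k) m n = 0.
Proof.
move=> h0; elim: k m n => // k IHk m n lt_mnk.
rewrite exprS coef2M big1 // => i _; rewrite big1 // => j _.
have [/andP[/eqP-> /eqP->]|ij0] := boolP ((i == 0 :> nat) && (j == 0 :> nat)).
  by rewrite h0 mul0r.
rewrite IHk ?mulr0 // -ltnS; apply: leq_trans lt_mnk.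
have im : (i <= m)%N by rewrite -ltnS.
have jn : (j <= n)%N by rewrite -ltnS.
have e : (m - i + (n - j) + (i + j) = m + n)%N by rewrite addnACA !subnK.
rewrite ltnS -e -[ltnLHS]addn0 ltn_add2l.
by rewrite addn_gt0 !lt0n -negb_and.
Qed.

Definition fps2_a : fps2 K := Fps2 (fun m n => ((m == 1%N) && (n == 0%N))%:R).
Definition fps2_b : fps2 K := Fps2 (fun m n => ((m == 0%N) && (n == 1%N))%:R).

End Ring.

Section UnitRing.
Variable K : comUnitRingType.
Implicit Types f g : fps2 K.

Definition fps2_unit : {pred fps2 K} :=
  fun f => coef2 f 0 0 \is a GRing.unit.

Let cst (c : K) : fps2 K :=
  Fps2 (fun m n => if (m == 0%N) && (n == 0%N) then c else 0).

Let coef2_cstM c f m n : coef2 (cst c * f) m n = c * coef2 f m n.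
Proof.
rewrite coef2M big_ord_recl big_ord_recl /= !subn0.
rewrite big1 => [|j _]; last by rewrite mul0r.
rewrite big1 ?addr0 // => i _.
by rewrite big1 // => j _; rewrite mul0r.
Qed.

(* With c the constant coefficient of f and h := 1 - c^-1 f, one has
   f^-1 = c^-1 (1 + h + h^2 + ...), where h^k has no term of degree < k. *)
Definition fps2_inv f : fps2 K :=
  if f \in fps2_unit then
    Fps2 (fun m n => (coef2 f 0 0)^-1 * \sum_(k < (m + n).+1)
      coef2 ((1 - Fps2 (fun i j => (coef2 f 0 0)^-1 * coef2 f i j)) ^+ k) m n)
  else f.

Fact fps2_mulVx : {in fps2_unit, left_inverse 1 fps2_inv *%R}.
Proof.
move=> f Uf; rewrite /fps2_inv Uf; set c := coef2 f 0 0.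
have Uc : c \is a GRing.unit by exact: Uf.
pose f1 : fps2 K := Fps2 (fun i j => c^-1 * coef2 f i j).
pose h : fps2 K := 1 - f1.
have h0 : coef2 h 0 0 = 0.
  by transitivity (1 - c^-1 * c) => //; rewrite mulVr ?subrr.
have f1E : f1 = cst c^-1 * f by apply: fps2P => m n; rewrite coef2_cstM.
pose s : fps2 K := Fps2 (fun m n => \sum_(k < (m + n).+1) coef2 (h ^+ k) m n).
rewrite [X in X * f](_ : _ = cst c^-1 * s); last first.
  by apply: fps2P => m n; rewrite coef2_cstM.
rewrite mulrAC -f1E; have -> : f1 = 1 - h by rewrite /h opprB addrC subrK.
apply: fps2P => m n.
pose N := (m + n).+1.
have -> : coef2 ((1 - h) * s) m n = coef2 ((1 - h) * \sum_(k < N) h ^+ k) m n.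
  rewrite !coef2M; apply: eq_bigr => i _; apply: eq_bigr => j _.
  congr (_ * _); rewrite coef2_sum /=.
  have le : ((m - i + (n - j)).+1 <= N)%N by rewrite ltnS leq_add ?leq_subr.
  rewrite (big_ord_widen N (fun k => coef2 (h ^+ k) (m - i) (n - j)) le).
  rewrite big_mkcond /=; apply: eq_bigr => k _; case: ifPn => // nk.
  by rewrite coef2_exp_small // ltnNge -ltnS.
have -> : (1 - h) * \sum_(k < N) h ^+ k = 1 - h ^+ N.
  by rewrite -(opprB (h ^+ N)) subrX1 -mulNr (opprB h).
transitivity (coef2 (1 : fps2 K) m n - coef2 (h ^+ N) m n) => //.
by rewrite coef2_exp_small // subr0.
Qed.

Fact fps2_unitPl f g : g * f = 1 -> fps2_unit f.
Proof.
move=> /(congr1 (fun p => coef2 p 0 0)); rewrite coef2M !big_ord1 /= => gf.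
by apply/unitrPr; exists (coef2 g 0 0); rewrite mulrC.
Qed.

Fact fps2_inv_out : {in [predC fps2_unit], fps2_inv =1 id}.
Proof.
move=> f; rewrite inE /fps2_inv => /negbTE.
by case: (f \in fps2_unit).
Qed.

HB.instance Definition _ := GRing.ComNzRing_hasMulInverse.Build (fps2 K)
  fps2_mulVx fps2_unitPl fps2_inv_out.

End UnitRing.

(* Sums and products of families indexed by a possibly infinite set D: limit,
   for the topology of coefficientwise stabilization, of the net of finite
   partial sums (resp. products). *)
Section Infinite.
Variables (K : comNzRingType) (I : choiceType).
Implicit Types (D : set I) (F : I -> fps2 K).

Definition is_fps2_sum D F (S : fps2 K) : Prop :=
  forall m n, exists2 A0 : {fset I}, ([set` A0] `<=` D)%classic &
    forall A : {fset I}, (A0 `<=` A)%fset -> ([set` A] `<=` D)%classic ->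
      coef2 (\sum_(i <- A) F i) m n = coef2 S m n.

Definition is_fps2_prod D F (P : fps2 K) : Prop :=
  forall m n, exists2 A0 : {fset I}, ([set` A0] `<=` D)%classic &
    forall A : {fset I}, (A0 `<=` A)%fset -> ([set` A] `<=` D)%classic ->
      coef2 (\prod_(i <- A) F i) m n = coef2 P m n.

Definition fps2_summable D F : Prop := exists S, is_fps2_sum D F S.
Definition fps2_multipliable D F : Prop := exists P, is_fps2_prod D F P.

(* The default values are taken only if the family does not converge. *)
Definition fps2_sum D F : fps2 K := xget 0 [set S | is_fps2_sum D F S]%classic.
Definition fps2_prod D F : fps2 K := xget 1 [set P | is_fps2_prod D F P]%classic.

Let net_lim_unique D (c : {fset I} -> fps2 K) (S T : fps2 K) :
  (forall m n, exists2 A0 : {fset I}, ([set` A0] `<=` D)%classic &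
    forall A : {fset I}, (A0 `<=` A)%fset -> ([set` A] `<=` D)%classic ->
      coef2 (c A) m n = coef2 S m n) ->
  (forall m n, exists2 A0 : {fset I}, ([set` A0] `<=` D)%classic &
    forall A : {fset I}, (A0 `<=` A)%fset -> ([set` A] `<=` D)%classic ->
      coef2 (c A) m n = coef2 T m n) ->
  S = T.
Proof.
move=> cS cT; apply: fps2P => m n.
have [A AD HA] := cS m n; have [B BD HB] := cT m n.
have ABD : ([set` (A `|` B)%fset] `<=` D)%classic.
  by move=> x /=; rewrite in_fsetU => /orP[/AD|/BD].
by rewrite -(HA _ (fsubsetUl A B) ABD) -(HB _ (fsubsetUr A B) ABD).
Qed.

Lemma is_fps2_sum_unique D F S T :
  is_fps2_sum D F S -> is_fps2_sum D F T -> S = T.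
Proof. exact: net_lim_unique. Qed.

Lemma is_fps2_prod_unique D F P Q :
  is_fps2_prod D F P -> is_fps2_prod D F Q -> P = Q.
Proof. exact: net_lim_unique. Qed.

Lemma fps2_sumP D F S : is_fps2_sum D F S -> fps2_sum D F = S.
Proof.
by move=> DS; apply: xget_unique => // T DT; exact: is_fps2_sum_unique DT DS.
Qed.

Lemma fps2_prodP D F P : is_fps2_prod D F P -> fps2_prod D F = P.
Proof.
by move=> DP; apply: xget_unique => // Q DQ; exact: is_fps2_prod_unique DQ DP.
Qed.

End Infinite.

Definition is_intpart (lam : seq nat) : bool := sorted geq lam && (0%N \notin lam).

(* lambda_i, numbered from i = 1. *)
Definition part (lam : seq nat) (i : nat) : nat := nth 0%N lam i.-1.

Definition Par (R : set nat) (gamma : nat -> nat) : set (seq nat) :=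
  [set lam | is_intpart lam /\
     forall r, R r -> (count_mem r lam <= gamma r)%N]%classic.

Section Series.
Variable K : comUnitRingType.
Local Notation a := (fps2_a K).
Local Notation b := (fps2_b K).

(* The sums over i >= 1 may be cut at i = size lam: the later parts are 0. *)
Definition omega2 (lam : seq nat) : fps2 K :=
  a ^+ (\sum_(1 <= i < (size lam).+1) uphalf (part lam (2 * i - 1)))%N *
  b ^+ (\sum_(1 <= i < (size lam).+1) (part lam (2 * i - 1))./2)%N *
  a ^+ (\sum_(1 <= i < (size lam).+1) uphalf (part lam (2 * i)))%N *
  b ^+ (\sum_(1 <= i < (size lam).+1) (part lam (2 * i))./2)%N.

Definition Psi (R : set nat) (gamma : nat -> nat) : fps2 K :=
  fps2_sum (Par R gamma) omega2.

Definition U_factor (j : nat) : fps2 K :=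
  (1 + a ^+ uphalf j * b ^+ j./2 * a ^+ uphalf (j - 1) * b ^+ (j - 1)./2) /
  ((1 - a ^+ (2 * uphalf j) * b ^+ (2 * j./2)) *
   (1 - a ^+ (2 * j - 1) * b ^+ (2 * j - 1))).

Definition V_factor (gamma : nat -> nat) (r : nat) : fps2 K :=
  1 - a ^+ (uphalf r * (gamma r + 1)) * b ^+ (r./2 * (gamma r + 1)).

End Series.

(* Main.v *)
Require Import Defs.
From HB Require Import structures.
From mathcomp Require Import all_boot all_order all_algebra finmap.
From mathcomp Require Import boolp classical_sets.
From mathcomp Require Import zify ring.
Set Implicit Arguments.
Unset Strict Implicit.
Unset Printing Implicit Defensive.
Import GRing.Theory.
Local Open Scope ring_scope.

(* A part k weighs w k := a^(ceil(k/2)) b^(floor(k/2)) whatever its position, so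
   Psi is the product over k >= 1 of the geometric sums of w k, cut after the
   exponent gamma k when k is in R; multiplying by all the 1 - w k gives V. The
   weights satisfy w(j) w(j-1) = w(2j-1), w(2i)^2 = w(4i) and
   (ab)^(2j-1) = w(4j-2), so U is the product of 1 / (1 - w k). All identities
   are proved for finite products, modulo terms of large degree. *)

(** * Power series modulo high total degree, and convergence of infinite products *)

Section Order.
Variable K : comNzRingType.
Implicit Types f g h : fps2 K.

Definition order_ge N f := forall m n, (m + n < N)%N -> coef2 f m n = 0.

Lemma order_ge_le M N f : order_ge N f -> (M <= N)%N -> order_ge M f.
Proof. by move=> fN MN m n mn; apply: fN; apply: leq_trans MN. Qed.

Lemma order_ge0 N : order_ge N (0 : fps2 K).
Proof. by []. Qed.

Lemma order_geD N f g : order_ge N f -> order_ge N g -> order_ge N (f + g).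
Proof.
by move=> fN gN m n mn; rewrite -[LHS]/(coef2 f m n + coef2 g m n) fN ?gN ?addr0.
Qed.

Lemma order_geN N f : order_ge N f -> order_ge N (- f).
Proof. by move=> fN m n mn; rewrite -[LHS]/(- coef2 f m n) fN ?oppr0. Qed.

Lemma order_geM M N f g :
  order_ge M f -> order_ge N g -> order_ge (M + N) (f * g).
Proof.
move=> fM gN m n mn; rewrite coef2M big1 // => i _; rewrite big1 // => j _.
have [ijM|ijM] := ltnP (i + j) M; first by rewrite fM // mul0r.
by rewrite gN ?mulr0 //; have := ltn_ord i; have := ltn_ord j; lia.
Qed.

Lemma order_geMl N f g : order_ge N g -> order_ge N (f * g).
Proof. by move=> gN; rewrite -[N]add0n; apply: order_geM. Qed.

Lemma order_geX N k f : order_ge N f -> order_ge (N * k) (f ^+ k).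
Proof.
move=> fN; elim: k => [|k IHk]; first by rewrite muln0.
by rewrite exprS mulnS; apply: order_geM.
Qed.

Lemma order_ge_monomial i j : order_ge (i + j) (fps2_a K ^+ i * fps2_b K ^+ j).
Proof.
apply: order_geM.
- by rewrite -[i in order_ge i]mul1n; apply: order_geX => -[|m] [|n].
- by rewrite -[j in order_ge j]mul1n; apply: order_geX => -[|m] [|n].
Qed.

(** Congruence modulo the ideal of series with no term of total degree below [N]; being a
    congruence, it passes through products. *)
Definition eq_upto N f g := order_ge N (f - g).

Lemma eq_upto_coef N f g m n :
  eq_upto N f g -> (m + n < N)%N -> coef2 f m n = coef2 g m n.
Proof. by move=> fg /fg /eqP; rewrite -[coef2 _ m n]/(_ - _) subr_eq0 => /eqP. Qed.

Lemma coef_eq_upto N f g :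
  (forall m n, (m + n < N)%N -> coef2 f m n = coef2 g m n) -> eq_upto N f g.
Proof.
by move=> fg m n /fg fgmn; rewrite -[LHS]/(coef2 f m n - coef2 g m n) fgmn subrr.
Qed.

Lemma eq_upto_le M N f g : eq_upto N f g -> (M <= N)%N -> eq_upto M f g.
Proof. exact: order_ge_le. Qed.

Lemma eq_upto_refl N f : eq_upto N f f.
Proof. by rewrite /eq_upto subrr; apply: order_ge0. Qed.
#[local] Hint Resolve eq_upto_refl : core.

Lemma eq_upto_sym N f g : eq_upto N f g -> eq_upto N g f.
Proof. by move/order_geN; rewrite opprB. Qed.

Lemma eq_upto_trans N f g h : eq_upto N f g -> eq_upto N g h -> eq_upto N f h.
Proof. by move=> fg gh; have := order_geD fg gh; rewrite addrA subrK. Qed.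

Lemma eq_uptoM N f f' g g' :
  eq_upto N f f' -> eq_upto N g g' -> eq_upto N (f * g) (f' * g').
Proof.
move=> ff gg; rewrite /eq_upto.
have -> : f * g - f' * g' = f * (g - g') + g' * (f - f') by ring.
by apply: order_geD; apply: order_geMl.
Qed.

Lemma eq_upto_prod N (I : Type) (r : seq I) (P : pred I) (F G : I -> fps2 K) :
  (forall i, P i -> eq_upto N (F i) (G i)) ->
  eq_upto N (\prod_(i <- r | P i) F i) (\prod_(i <- r | P i) G i).
Proof.
move=> FG; elim/big_rec2: _ => // i f g Pi fg.
by apply: eq_uptoM => //; apply: FG.
Qed.

Lemma eq_upto_prod1 N (I : Type) (r : seq I) (P : pred I) (F : I -> fps2 K) :
  (forall i, P i -> eq_upto N (F i) 1) -> eq_upto N (\prod_(i <- r | P i) F i) 1.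
Proof.
move=> F1; elim/big_rec: _ => // i f Pi f1.
by rewrite -[X in eq_upto _ _ X]mulr1; apply: eq_uptoM => //; apply: F1.
Qed.

Lemma eq_upto_1D N f : order_ge N f -> eq_upto N (1 + f) 1.
Proof. by rewrite /eq_upto addrAC subrr add0r. Qed.

Lemma eq_upto_1B N f : order_ge N f -> eq_upto N (1 - f) 1.
Proof. by move=> /order_geN; apply: eq_upto_1D. Qed.

(** When each [F i] is 1 below degree [i], factors of index above [m + n] cannot affect the
    coefficient at [(m, n)], so a finite product gives each coefficient of the limit. *)
Definition prod_limit (D : set nat) (F : nat -> fps2 K) : fps2 K :=
  Fps2 (fun m n => coef2 (\prod_(0 <= i < (m + n).+1 | `[< D i >]) F i) m n).

Lemma eq_upto_prod_widen (D : set nat) (F : nat -> fps2 K) M N :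
  (forall i, D i -> eq_upto i (F i) 1) -> (N <= M)%N ->
  eq_upto N (\prod_(0 <= i < M | `[< D i >]) F i)
            (\prod_(0 <= i < N | `[< D i >]) F i).
Proof.
move=> F1 NM; rewrite (big_cat_nat_idem _ _ NM) //=; last exact: mulr1.
rewrite -[X in eq_upto _ _ X]mulr1; apply: eq_uptoM => //.
rewrite big_nat_cond.
apply: eq_upto_prod1 => i /andP[/andP[Ni _] /asboolP Di].
exact: (eq_upto_le (F1 i Di) Ni).
Qed.

Lemma prod_limit_eq_upto (D : set nat) (F : nat -> fps2 K) M N :
  (forall i, D i -> eq_upto i (F i) 1) -> (N <= M)%N ->
  eq_upto N (prod_limit D F) (\prod_(0 <= i < M | `[< D i >]) F i).
Proof.
move=> F1 NM; apply: coef_eq_upto => m n mnN /=.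
apply: esym; apply: eq_upto_coef (ltnSn _).
by apply: eq_upto_prod_widen => //; apply: leq_trans NM.
Qed.

Lemma prod_limitP (D : set nat) (F : nat -> fps2 K) :
  (forall i, D i -> eq_upto i (F i) 1) -> is_fps2_prod D F (prod_limit D F).
Proof.
move=> F1 m n; pose N := (m + n).+1.
(* Beyond the indices of [D] below [N], every further factor is 1 modulo degree [N]. *)
exists [fset i in iota 0 N | `[< D i >]]%fset.
  by move=> i /=; rewrite !inE => /andP[_ /asboolP].
move=> A /fsubsetP A0A AD; apply: (@eq_upto_coef N) => //.
apply: eq_upto_trans (eq_upto_sym (prod_limit_eq_upto F1 (leqnn N))).
have -> : \prod_(0 <= i < N | `[< D i >]) F i = \prod_(i <- A | (i < N)%N) F i.
  rewrite -big_filter -[RHS]big_filter; apply: perm_big.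
  apply: uniq_perm; rewrite ?filter_uniq ?iota_uniq ?fset_uniq // => i.
  rewrite !mem_filter mem_index_iota leq0n /=.
  apply/andP/andP => [[Di iN]|[iN iA]]; split=> //; last first.
    by apply/asboolP; apply: AD.
  by apply: A0A; rewrite in_fset inE Di andbT [_ \in _]mem_iota.
rewrite big_seq [X in eq_upto _ _ X]big_seq_cond [X in eq_upto _ _ X]big_mkcondr /=.
apply: eq_upto_prod => i iA; case: ltnP => // Ni.
exact: (eq_upto_le (F1 i (AD i iA)) Ni).
Qed.

End Order.

#[local] Hint Resolve eq_upto_refl : core.

(** * Partitions with bounded parts and bounded multiplicities *)

Lemma geq_trans : transitive geq.
Proof. by move=> y z t zy yt; apply: leq_trans yt zy. Qed.

Lemma count_le_sumn (l : seq nat) i : 0%N \notin l -> (count_mem i l <= sumn l)%N.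
Proof.
elim: l => //= x l IHl; rewrite inE negb_or => /andP[x0 /IHl].
by move: x0; case: eqP; lia.
Qed.

Lemma mem_le_sumn (l : seq nat) i : i \in l -> (i <= sumn l)%N.
Proof. by elim: l => //= x l IHl; rewrite inE => /predU1P[->|/IHl]; lia. Qed.

(** Built by choosing the block of copies of the largest allowed part. The bound [c] is strict, so
    [c i] counts the admissible multiplicities of [i], hence the terms of its geometric sum. *)
Fixpoint partitions_below (c : nat -> nat) n : seq (seq nat) :=
  if n is n'.+1 then
    [seq nseq e n ++ l | e <- iota 0 (c n), l <- partitions_below c n']
  else [:: [::]].

Lemma sorted_split_max n l : sorted geq l -> all (geq n.+1) l ->
  exists e l', l = nseq e n.+1 ++ l' /\ all (geq n) l'.
Proof.
elim: l => [|x l IHl] => [_ _|]; first by exists 0%N, [::].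
rewrite [sorted _ _]/= => xl /= /andP[xn ln].
move: xn; rewrite leq_eqVlt => /predU1P[->|xn].
  have [e [l' [-> l'n]]] := IHl (path_sorted xl) ln.
  by exists e.+1, l'.
exists 0%N, (x :: l); split=> //=; rewrite -ltnS xn /=.
move: (order_path_min geq_trans xl); apply: sub_all => y /= yx.
by rewrite -ltnS (leq_ltn_trans yx xn).
Qed.

Lemma is_intpart_cat_nseq e n l : all (geq n) l ->
  is_intpart (nseq e n.+1 ++ l) = is_intpart l.
Proof.
move=> ln; rewrite /is_intpart mem_cat negb_or mem_nseq andbF /=; congr (_ && _).
rewrite !(sorted_pairwise geq_trans) pairwise_cat.
have -> : pairwise geq (nseq e n.+1).
  elim: e => //= e ->; rewrite andbT; apply/allP => y /nseqP[-> _].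
  exact: leqnn.
suff -> : allrel geq (nseq e n.+1) l by [].
apply/allrelP => x y /nseqP[-> _] /(allP ln) /= yn.
exact: leq_trans yn _.
Qed.

(** The list constrains only multiplicities of parts from 1 to [n]; every other multiplicity is 0,
    and positivity of [c] makes its bound hold. *)
Lemma partitions_belowP c n l : (forall i, 0 < c i)%N ->
  reflect [/\ is_intpart l, all (geq n) l & forall i, (count_mem i l < c i)%N]
          (l \in partitions_below c n).
Proof.
move=> c_gt0; elim: n l => [|n IHn] l /=.
  rewrite inE; apply: (iffP eqP) => [->|[/andP[_ l0] ln _]]; first by split.
  by case: l l0 ln => // -[|x] l.
have count0 l' : all (geq n) l' -> count_mem n.+1 l' = 0%N.
  move=> l'n; apply/count_memPn; apply/negP => /(allP l'n) /=.
  by rewrite ltnn.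
apply: (iffP allpairsPdep) => [[e [l' [ec /IHn[l'p l'n l'c] ->]]]|[lp ln lc]].
  rewrite mem_iota add0n /= in ec; split.
  - by rewrite is_intpart_cat_nseq.
  - rewrite all_cat; apply/andP; split.
      by apply/allP => y /nseqP[-> _]; exact: leqnn.
    by apply: sub_all l'n => y /= yn; apply: leq_trans yn _.
  - move=> i; rewrite count_cat count_nseq /= eq_sym.
    case: eqVneq => [->|_]; last by rewrite add0n.
    by rewrite mul1n count0 // addn0.
have [e [l' [lE l'n]]] := sorted_split_max (proj1 (andP lp)) ln.
subst l; exists e, l'; split=> //.
  rewrite mem_iota add0n /=; have := lc n.+1.
  by rewrite count_cat count_nseq /= eqxx mul1n count0 // addn0.
apply/IHn; split=> // [|i]; first by rewrite is_intpart_cat_nseq in lp.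
by apply: leq_ltn_trans (lc i); rewrite count_cat leq_addl.
Qed.

(** The block length is recovered as the multiplicity of the largest allowed part, and the rest by
    cancelling that block. *)
Lemma partitions_below_uniq c n : (forall i, 0 < c i)%N ->
  uniq (partitions_below c n).
Proof.
move=> c_gt0; elim: n => //= n IHn; apply: allpairs_uniq => //.
  exact: iota_uniq.
have count0 l : l \in partitions_below c n -> count_mem n.+1 l = 0%N.
  move=> /partitions_belowP -/(_ c_gt0)[_ ln _].
  by apply/count_memPn; apply/negP => /(allP ln) /=; rewrite ltnn.
move=> _ _ /allpairsP[[e l] [_ /= lP ->]] /allpairsP[[e' l'] [_ /= l'P ->]].
move=> /= eq_l; have /eqP := congr1 (count_mem n.+1) eq_l.
rewrite !count_cat !count_nseq /= eqxx !mul1n !count0 // !addn0 => /eqP ee'.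
rewrite -{}ee' in eq_l *.
by have /eqP := eq_l; rewrite eqseq_cat // eqxx => /eqP->.
Qed.

(** * Weights of parts, the product U and the generating function of bounded partitions *)

Section Weights.
Variable K : comUnitRingType.
Implicit Types f g h : fps2 K.
Local Notation a := (fps2_a K).
Local Notation b := (fps2_b K).

Lemma unit_1B f : order_ge 1 f -> 1 - f \is a GRing.unit.
Proof.
move=> f0; have e : coef2 (1 - f) 0 0 = 1.
  by rewrite -[LHS]/(1 - coef2 f 0 0) f0 // subr0.
by rewrite -[_ \is a _]/(coef2 (1 - f) 0 0 \is a GRing.unit) e unitr1.
Qed.

Lemma eq_upto_mulIr N f g h : h \is a GRing.unit ->
  eq_upto N (f * h) (g * h) -> eq_upto N f g.
Proof.
by move=> Uh fg; have := eq_uptoM fg (@eq_upto_refl _ N h^-1); rewrite !mulrK.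
Qed.

Lemma eq_uptoV1 N f : f \is a GRing.unit -> eq_upto N f 1 -> eq_upto N f^-1 1.
Proof.
move=> Uf f1; apply: (eq_upto_mulIr Uf); rewrite mulVr // mul1r.
exact: eq_upto_sym.
Qed.

Definition part_weight k : fps2 K := a ^+ uphalf k * b ^+ k./2.
Local Notation w := part_weight.

Lemma order_ge_part_weight k : order_ge k (w k).
Proof.
have {1}-> : k = (uphalf k + k./2)%N by lia.
exact: order_ge_monomial.
Qed.

Lemma unit_1B_part_weightX k e : (0 < k)%N -> (0 < e)%N ->
  1 - w k ^+ e \is a GRing.unit.
Proof.
move=> k0 e0; apply: unit_1B; apply: (order_ge_le (order_geX (@order_ge_part_weight k)) _).
by rewrite muln_gt0 k0.
Qed.

Lemma unit_1B_part_weight k : (0 < k)%N -> 1 - w k \is a GRing.unit.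
Proof. by move=> k0; rewrite -[w k]expr1; apply: unit_1B_part_weightX. Qed.

Lemma sum_nth_pairs (F : nat -> nat) (lam : seq nat) : F 0%N = 0%N ->
  (\sum_(1 <= i < (size lam).+1) F (part lam (2 * i - 1)) +
   \sum_(1 <= i < (size lam).+1) F (part lam (2 * i)) = \sum_(k <- lam) F k)%N.
Proof.
move=> F0.
have pairs n : (\sum_(1 <= i < n.+1) F (part lam (2 * i - 1)) +
    \sum_(1 <= i < n.+1) F (part lam (2 * i)) =
    \sum_(0 <= i < n.*2) F (nth 0 lam i))%N.
  elim: n => [|n IHn]; first by rewrite !big_geq.
  rewrite doubleS [RHS]big_nat_recr // [X in _ = (X + _)%N]big_nat_recr // -IHn.
  rewrite big_nat_recr // [X in (_ + X)%N = _]big_nat_recr //=.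
  rewrite /part (_ : (2 * n.+1 - 1).-1 = n.*2)%N; last lia.
  rewrite (_ : (2 * n.+1).-1 = n.*2.+1)%N; last lia.
  by lia.
(* The paired sums run over twice the length of [lam]; the excess positions hold the default part 0,
   where [F] vanishes. *)
rewrite pairs [RHS](big_nth 0%N) (@big_cat_nat _ _ _ (size lam)) //=; last lia.
rewrite [X in (_ + X)%N]big_nat_cond [X in (_ + X)%N]big1 ?addn0 // => i /andP[/andP[si _] _].
by rewrite nth_default.
Qed.

Lemma omega2E lam : omega2 K lam = \prod_(k <- lam) w k.
Proof.
rewrite big_split /= !prodrXr /omega2.
rewrite -(@sum_nth_pairs uphalf) // -(@sum_nth_pairs half) // !exprD.
by ring.
Qed.

(** Since [w k] is a monomial of degree [k], only partitions of size at most [m + n] can reach the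
    coefficient at [(m, n)]. *)
Lemma order_ge_omega2 lam : order_ge (sumn lam) (omega2 K lam).
Proof.
rewrite omega2E; elim: lam => // k lam IHlam; rewrite big_cons /=.
by apply: order_geM => //; apply: order_ge_part_weight.
Qed.

Lemma V_factorE gamma r : V_factor K gamma r = 1 - w r ^+ (gamma r).+1.
Proof. by rewrite /V_factor exprMn -!exprM addn1. Qed.

Lemma V_factor_eq_upto1 gamma r : eq_upto r (V_factor K gamma r) 1.
Proof.
rewrite V_factorE; apply: eq_upto_1B.
apply: (order_ge_le (order_geX (@order_ge_part_weight r)) _).
by rewrite mulnS leq_addr.
Qed.

Lemma U_factorE j : U_factor K j.+1 =
  (1 + w j.*2.+1) / ((1 - w j.+1 ^+ 2) * (1 - w (j.*2.+1).*2)).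
Proof.
rewrite /U_factor subn1 /= /part_weight; congr ((1 + _) / ((1 - _) * (1 - _))).
- rewrite -mulrA mulrACA -!exprD.
  by congr (_ ^+ _ * _ ^+ _); rewrite /= ?uphalf_double ?doubleK; lia.
- by rewrite exprMn -!exprM ![(_ * 2)%N]mulnC.
- by rewrite uphalf_double doubleK; congr (_ ^+ _ * _ ^+ _); lia.
Qed.

Lemma U_factor_eq_upto1 j : (0 < j)%N -> eq_upto j (U_factor K j) 1.
Proof.
case: j => // j _; rewrite U_factorE -[X in eq_upto _ _ X]mulr1.
apply: eq_uptoM.
  apply: eq_upto_1D; apply: (order_ge_le (@order_ge_part_weight _) _); lia.
apply: eq_uptoV1.
  by rewrite unitrM unit_1B_part_weightX // unit_1B_part_weight.
rewrite -[X in eq_upto _ _ X]mulr1; apply: eq_uptoM; apply: eq_upto_1B.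
  by apply: (order_ge_le (order_geX (@order_ge_part_weight _)) _); lia.
by apply: (order_ge_le (@order_ge_part_weight _) _); lia.
Qed.

(* The factors 1 - w(2j+1)^2 and 1 - w(4j+2) of the denominator of U are
   cancelled at different rates; their quotient measures the gap. *)
Definition U_defect j : fps2 K := (1 - w j.*2.+1 ^+ 2) / (1 - w (j.*2.+1).*2).

(** The inductive step of [prod_U_factor] in abstract form: x = w(4n+1), y = w(4n+3), A = 1 -
    w(2n+1)^2, B = 1 - w(4n+2), C = 1 - w(4n+4), D = 1 - w(8n+2), E = 1 - w(8n+6). *)
Lemma U_defect_rec (T : comUnitRingType) (x y A B C D E : T) :
  A \is a GRing.unit -> B \is a GRing.unit -> C \is a GRing.unit ->
  D \is a GRing.unit -> E \is a GRing.unit ->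
  (1 + x) / (A * D) * ((1 + y) / (C * E)) *
  ((1 - x) * B * (1 - y) * C) * (A / B) =
  (1 - x ^+ 2) / D * ((1 - y ^+ 2) / E).
Proof.
move=> UA UB UC UD UE; rewrite !invrM //.
have := mulrV UA; have := mulrV UB; have := mulrV UC.
(* With the inverses turned into variables, [ring] proves a polynomial identity; the three relations
   then remove the extra factors. *)
move: A^-1 B^-1 C^-1 D^-1 E^-1 => A' B' C' D' E' CV BV AV.
transitivity ((1 - x ^+ 2) * D' * ((1 - y ^+ 2) * E') *
  (A * A') * (B * B') * (C * C')); last by rewrite AV BV CV !mulr1.
by ring.
Qed.

(* Both products of defects tend to the same limit: U * prod_k (1 - w k) = 1. *)
Lemma prod_U_factor n :
  \prod_(0 <= j < n.*2) U_factor K j.+1 *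
  \prod_(0 <= i < n.*2.*2) (1 - w i.+1) * \prod_(0 <= j < n) U_defect j =
  \prod_(0 <= j < n.*2) U_defect j.
Proof.
elim: n => [|n IHn]; first by rewrite !big_geq // !mulr1.
(* Raising [n] by one adds two factors of U, four factors [1 - w k] and one defect on the left, and
   two defects on the right. *)
have step : U_factor K n.*2.+1 * U_factor K n.*2.+2 *
    ((1 - w n.*2.*2.+1) * (1 - w n.*2.*2.+2) * (1 - w n.*2.*2.+3) *
     (1 - w n.*2.*2.+4)) * U_defect n = U_defect n.*2 * U_defect n.*2.+1.
  have w2 : w n.*2.+2 ^+ 2 = w n.*2.*2.+4.
    by rewrite /part_weight exprMn -!exprM; congr (_ ^+ _ * _ ^+ _); lia.
  rewrite !U_factorE w2 /U_defect !doubleS; apply: U_defect_rec;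
    by rewrite ?unit_1B_part_weightX ?unit_1B_part_weight.
have regroup (X Y Z u1 u2 p1 p2 p3 p4 q : fps2 K) :
    X * u1 * u2 * (Y * p1 * p2 * p3 * p4) * (Z * q) =
    X * Y * Z * (u1 * u2 * (p1 * p2 * p3 * p4) * q) by ring.
rewrite !doubleS; do !rewrite big_nat_recr //=.
by rewrite regroup IHn step mulrA.
Qed.

(** The first [n] defects form a unit and can be cancelled in [prod_U_factor]. What remains are the
    defects of index from [n] to 2n - 1, each 1 modulo degree [n]. *)
Lemma prod_U_factor_eq_upto n :
  eq_upto n (\prod_(0 <= j < n.*2) U_factor K j.+1 *
             \prod_(0 <= i < n.*2.*2) (1 - w i.+1)) 1.
Proof.
have UQ : \prod_(0 <= j < n) U_defect j \is a GRing.unit.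
  apply: rpred_prod => j _.
  by rewrite unitrM unitrV unit_1B_part_weightX ?unit_1B_part_weight.
apply: (eq_upto_mulIr UQ); rewrite prod_U_factor mul1r.
have Q1 i : eq_upto i (U_defect i) 1.
  rewrite -[X in eq_upto _ _ X]mulr1; apply: eq_uptoM.
    apply: eq_upto_1B; apply: (order_ge_le (order_geX (@order_ge_part_weight _)) _).
    by lia.
  apply: eq_uptoV1; first exact: unit_1B_part_weight.
  by apply: eq_upto_1B; apply: (order_ge_le (@order_ge_part_weight _) _); lia.
have := @eq_upto_prod_widen _ setT U_defect n.*2 n (fun i _ => Q1 i).
by under eq_bigl do rewrite asboolT //;
   under [X in eq_upto _ _ X]eq_bigl do rewrite asboolT //; apply; lia.
Qed.

(** Euler's product argument: the weight is multiplicative under concatenation, so the choice of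
    each block of equal parts factors out. *)
Lemma sum_partitions_below c n :
  \sum_(l <- partitions_below c n) omega2 K l =
  \prod_(0 <= i < n) \sum_(e < c i.+1) w i.+1 ^+ e.
Proof.
elim: n => [|n IHn]; first by rewrite big_seq1 big_geq // omega2E big_nil.
rewrite big_nat_recr //= -IHn big_allpairs_dep /=.
rewrite -{1}[c n.+1]subn0 -/(index_iota 0 (c n.+1)) big_mkord mulrC mulr_suml.
apply: eq_bigr => e _; rewrite mulr_sumr; apply: eq_bigr => l _.
by rewrite !omega2E big_cat /= big_nseq -Monoid.iteropE.
Qed.

Lemma sum_partitions_belowM c n :
  (\sum_(l <- partitions_below c n) omega2 K l) *
  \prod_(0 <= i < n) (1 - w i.+1)
  = \prod_(0 <= i < n) (1 - w i.+1 ^+ c i.+1).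
Proof.
rewrite sum_partitions_below -big_split /=; apply: eq_bigr => i _.
by rewrite mulrC -[RHS]opprB subrX1 -[RHS]mulNr opprB.
Qed.

End Weights.

(** * Passage from finite products to the identity of power series *)

Theorem theorem2p4 (K : comUnitRingType) (R : set nat) (gamma : nat -> nat)
    (R_pos : forall r, R r -> (0 < r)%N)
    (gamma_pos : forall r, R r -> (0 < gamma r)%N) :
  [/\ fps2_summable (Par R gamma) (@omega2 K),
      fps2_multipliable [set j : nat | (1 <= j)%N]%classic (@U_factor K),
      fps2_multipliable R (@V_factor K gamma) &
      Psi K R gamma =
        fps2_prod [set j : nat | (1 <= j)%N]%classic (@U_factor K) *
        fps2_prod R (@V_factor K gamma)].
Proof.
set D := [set j : nat | (1 <= j)%N]%classic.
have U1 j : D j -> eq_upto j (@U_factor K j) 1 by exact: U_factor_eq_upto1.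
have V1 r : R r -> eq_upto r (@V_factor K gamma r) 1.
  by move=> _; exact: V_factor_eq_upto1.
have PU := prod_limitP U1; have PV := prod_limitP V1.
rewrite (fps2_prodP PU) (fps2_prodP PV).
suff S : is_fps2_sum (Par R gamma) (@omega2 K)
    (prod_limit D (@U_factor K) * prod_limit R (@V_factor K gamma)).
  split; [by exists (prod_limit D (@U_factor K) * prod_limit R (@V_factor K gamma))
    | by exists (prod_limit D (@U_factor K))
    | by exists (prod_limit R (@V_factor K gamma)) | exact: fps2_sumP].
(* [M] is 4N, the range of [1 - w k] in [prod_U_factor_eq_upto]. Outside [R] the cap [N] loses
   nothing in degree below [N]: a partition of size less than [N] has all multiplicities below
   [N]. *)
move=> m n; pose N := (m + n).+1; pose M := N.*2.*2.
pose c i := if `[< R i >] then (gamma i).+1 else N.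
have c_gt0 i : (0 < c i)%N by rewrite /c; case: ifP.
pose L := partitions_below c M.
have LPar l : l \in L -> Par R gamma l.
  move=> /partitions_belowP -/(_ c_gt0)[lp _ lc]; split=> // r Rr.
  by have := lc r; rewrite /c asboolT.
have ParL l : Par R gamma l -> (sumn l < N)%N -> l \in L.
  move=> [lp lc] lN; apply/partitions_belowP => //; split=> // [|i].
    by apply/allP => i /mem_le_sumn /=; rewrite /M; lia.
  rewrite /c; case: asboolP => [/lc|_] //.
  by apply: leq_ltn_trans lN; apply: count_le_sumn; case/andP: lp.
exists [fset l in L]%fset; first by move=> l /=; rewrite inE => /LPar.
move=> A /fsubsetP LA APar.
(* Members of [A] outside [L] have size at least [N], so their weights vanish at [(m, n)]. *)
have -> : coef2 (\sum_(l <- A) omega2 K l) m n = coef2 (\sum_(l <- L) omega2 K l) m n.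
  rewrite (bigID (mem L)) /= -[LHS]/(coef2 _ m n + coef2 _ m n) addrC.
  rewrite [X in X + _]coef2_sum big_seq_cond big1 ?add0r; last first.
    move=> l /andP[/APar lP lL]; apply: order_ge_omega2.
    by rewrite ltnNge; apply: contra lL => lN; apply: ParL.
  congr (coef2 _ m n); rewrite -big_filter; apply: perm_big.
  apply: uniq_perm; rewrite ?filter_uniq ?fset_uniq ?partitions_below_uniq // => l.
  by rewrite mem_filter andb_idr // => lL; apply: LA; rewrite inE.
apply: (@eq_upto_coef _ N) => //.
have PUN : eq_upto N (prod_limit D (@U_factor K))
    (\prod_(0 <= j < N.*2) U_factor K j.+1).
  apply: eq_upto_trans (prod_limit_eq_upto (M := N.*2.+1) U1 _) _; first lia.
  (* Index 0 lies outside [D] and contributes 1; the others are shifted by one. *)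
  rewrite big_mkcond big_nat_recl //= asboolF // mul1r.
  by apply: eq_upto_prod => j _; rewrite asboolT.
have PVN : eq_upto N (prod_limit R (@V_factor K gamma))
    (\prod_(0 <= i < M) (1 - part_weight K i.+1 ^+ c i.+1)).
  apply: eq_upto_trans (prod_limit_eq_upto (M := M.+1) V1 _) _; first by rewrite /M; lia.
  rewrite big_mkcond big_nat_recl //= asboolF ?mul1r; last by move/R_pos.
  (* For an index in [R] the factors coincide; otherwise the inserted factor 1 - w(i+1)^N is 1
     modulo degree [N]. *)
  apply: eq_upto_prod => i _; rewrite /c V_factorE; case: ifP => // _.
  apply: eq_upto_sym; apply: eq_upto_1B.
  apply: (order_ge_le (order_geX (@order_ge_part_weight _ _)) _).
  by rewrite mulSn leq_addr.
(* V is now the partition sum times the product of all [1 - w k], and that product cancels U modulo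
   degree [N]. *)
rewrite -sum_partitions_belowM -/L in PVN.
apply: eq_upto_sym; apply: eq_upto_trans (eq_uptoM PUN PVN) _.
rewrite mulrCA -[X in eq_upto _ _ X]mulr1; apply: eq_uptoM => //.
exact: prod_U_factor_eq_upto.
Qed.
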